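(* Let $x,w,y,z$ be parameters (elements of a field). Consider the following rules for a function $\xi$ from finite multigraphs to the field: (i) for every multigraph $G$ and every edge $e$ of $G$: $\xi(G)=w\cdot\xi(G_{-e})+y\cdot\xi(G_{/e})+z\cdot\xi(G_{\dagger e})$; (ii) $\xi(G_1\oplus G_2)=\xi(G_1)\cdot\xi(G_2)$ for all multigraphs $G_1,G_2$; (iii) $\xi(E_1)=x$; (iv) $\xi(\emptyset)=1$. This recurrence relation is confluent if and only if $z=0$ or $w=1$.
   Context: All graphs are finite multigraphs $G=(V,E)$: loops and multiple edges are allowed, vertices and edges are unlabeled. For an edge $e$ of $G$: $G_{-e}$ (deletion) is obtained from $G$ by removing $e$; $G_{/e}$ (contraction) is obtained by identifying the endpoints of $e$ (and removing $e$), which may create loops and multiple edges; $G_{\dagger e}$ (extraction) is the subgraph induced by $V\setminus\{u,v\}$ where $e=\{u,v\}$, i.e. $e$ is removed together with its endpoints and all edges incident to them. $G_1\oplus G_2$ is the disjoint union, $E_1$ is the graph with one vertex and no edges, and $\emptyset$ is the graph with no vertices. The recurrence is called confluent if evaluating $\xi$ on any multigraph by repeatedly applying the rules (choosing edges to eliminate and decompositions into disjoint unions in any order) always gives the same result, i.e. the rules define a graph invariant.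
   Formalization: The case where both x = 1 and w + y + z = 1 is excluded: there the constant 1 satisfies all the rules and every evaluation gives 1, so the recurrence is confluent even when z ≠ 0 and w ≠ 1, e.g. (x,w,y,z) = (1,0,0,1). *)

(* Defs.v *)
From HB Require Import structures.
From mathcomp Require Import all_boot all_order all_algebra.

Set Implicit Arguments.
Unset Strict Implicit.
Unset Printing Implicit Defensive.

Import GRing.Theory.
Local Open Scope ring_scope.

(* [ends e] is the set of endpoints of [e]: a pair, or a singleton when [e] is
   a loop. *)
Record multigraph := Multigraph {
  vertex : finType;
  edge : finType;
  ends : edge -> {set vertex};
  ends_card : forall e, (0 < #|ends e| <= 2)%N
}.

Definition isomorphic (G H : multigraph) : Prop :=
  exists (f : vertex G -> vertex H) (g : edge G -> edge H),
    [/\ bijective f, bijective g & forall e, ends (g e) = f @: ends e].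

Lemma imset_card_bounds (aT rT : finType) (f : aT -> rT) (A : {set aT}) :
  (0 < #|A| <= 2)%N -> (0 < #|f @: A| <= 2)%N.
Proof.
case/andP=> A0 A2; apply/andP; split; last first.
  by apply: leq_trans A2; apply: leq_imset_card.
by case/card_gt0P: A0 => x xA; apply/card_gt0P; exists (f x); apply: imset_f.
Qed.

Section EdgeElimination.
Variables (G : multigraph) (e : edge G).

Definition deletion_ends (f : {f : edge G | f != e}) : {set vertex G} :=
  ends (val f).

Definition deletion : multigraph :=
  @Multigraph (vertex G) {f : edge G | f != e} deletion_ends
    (fun f => ends_card (val f)).

(* Vertices off [e] are kept as [Some v]; both endpoints of [e] become [None],
   which is what [insub] computes. If [e] is a loop, this only renames its
   endpoint. *)
Definition contraction_vertex : finType :=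
  option {v : vertex G | v \notin ends e}.

Definition contraction_map (v : vertex G) : contraction_vertex := insub v.

Definition contraction_ends (f : {f : edge G | f != e}) :
  {set contraction_vertex} := contraction_map @: ends (val f).

Lemma contraction_ends_card f : (0 < #|contraction_ends f| <= 2)%N.
Proof. exact: imset_card_bounds (ends_card (val f)). Qed.

Definition contraction : multigraph :=
  @Multigraph contraction_vertex {f : edge G | f != e} contraction_ends
    contraction_ends_card.

(* The subgraph induced by the complement of [ends e]; [e] itself disappears
   since [ends e] is nonempty. *)
Definition extraction_vertex : finType := {v : vertex G | v \notin ends e}.

Definition extraction_edge : finType :=
  {f : edge G | [disjoint ends f & ends e]}.

Definition extraction_ends (f : extraction_edge) : {set extraction_vertex} :=
  [set v | val v \in ends (val f)].

Lemma extraction_ends_card f : (0 < #|extraction_ends f| <= 2)%N.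
Proof.
suff <- : #|ends (val f)| = #|extraction_ends f| by apply: ends_card.
rewrite -(card_imset (mem (extraction_ends f)) val_inj).
apply: eq_card => v; apply/idP/imsetP => [vf | [u]]; last by rewrite inE => ? ->.
have ve : v \notin ends e by rewrite (disjointFr (valP f) vf).
by exists (Sub v ve); rewrite ?inE SubK.
Qed.

Definition extraction : multigraph :=
  @Multigraph extraction_vertex extraction_edge extraction_ends
    extraction_ends_card.

End EdgeElimination.

Section DisjointUnion.
Variables G1 G2 : multigraph.

Definition disjoint_union_ends (e : edge G1 + edge G2) :
  {set vertex G1 + vertex G2} :=
  match e with
  | inl e1 => inl @: ends e1
  | inr e2 => inr @: ends e2
  end.

Lemma disjoint_union_ends_card e : (0 < #|disjoint_union_ends e| <= 2)%N.
Proof. by case: e => e; apply: imset_card_bounds (ends_card e). Qed.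

Definition disjoint_union : multigraph :=
  @Multigraph (vertex G1 + vertex G2)%type (edge G1 + edge G2)%type
    disjoint_union_ends disjoint_union_ends_card.

End DisjointUnion.

Definition edgeless (T : finType) : multigraph :=
  @Multigraph T void (fun e => match e with end) (fun e => match e with end).

Definition one_vertex_graph : multigraph := edgeless unit.
Definition empty_graph : multigraph := edgeless void.

(* [evaluates x w y z G a]: some complete evaluation of the recurrence on [G],
   with some choice of eliminated edges and of decompositions, gives [a].
   [eval_iso] expresses that vertices and edges are unlabeled. *)
Inductive evaluates (F : fieldType) (x w y z : F) : multigraph -> F -> Prop :=
| eval_edge (G : multigraph) (e : edge G) (a b c : F) :
    evaluates x w y z (deletion e) a ->
    evaluates x w y z (contraction e) b ->
    evaluates x w y z (extraction e) c ->
    evaluates x w y z G (w * a + y * b + z * c)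
| eval_union (G1 G2 : multigraph) (a b : F) :
    evaluates x w y z G1 a ->
    evaluates x w y z G2 b ->
    evaluates x w y z (disjoint_union G1 G2) (a * b)
| eval_one_vertex : evaluates x w y z one_vertex_graph x
| eval_empty : evaluates x w y z empty_graph 1
| eval_iso (G H : multigraph) (a : F) :
    isomorphic G H -> evaluates x w y z G a -> evaluates x w y z H a.

Definition confluent (F : fieldType) (x w y z : F) : Prop :=
  forall (G : multigraph) (a b : F),
    evaluates x w y z G a -> evaluates x w y z G b -> a = b.

(* When x = 1 and w + y + z = 1, every evaluation gives 1, so the recurrence is
   confluent whatever z and w are, e.g. for (x, w, y, z) = (1, 0, 0, 1). *)
Lemma confluent_constant (F : fieldType) (x w y z : F) :
  x = 1 -> w + y + z = 1 -> confluent x w y z.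
Proof.
move=> x1 wyz1.
have ev1 G a : evaluates x w y z G a -> a = 1.
  by elim=> {G a} [G e a b c _ -> _ -> _ -> | G H a b _ -> _ -> | | |];
    rewrite ?mulr1.
by move=> G a b /ev1 -> /ev1 ->.
Qed.

(* Main.v *)
(** Eliminate the edges in the order given by a list. Exchanging two consecutive
    edges [e], [f] that share no endpoint does not change the value; if they do
    share one, the value changes by
      [z (1 - w) (xi (G minus the ends of e) - xi (G minus the ends of f))],
    where both arguments have lost the edges [e] and [f].
    If [z = 0] or [w = 1] the value is therefore independent of the order, hence
    a graph invariant satisfying all four rules. Conversely, every order is a
    legitimate evaluation: with [e] a loop at one end of the edge [f],
    confluence forces [x = 1], and with a further loop at the other end of [f]
    it forces [(w + y) x + z = 1]. *)

Require Import Defs.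
From HB Require Import structures.
From mathcomp Require Import all_boot all_order all_algebra ring.

Set Implicit Arguments.
Unset Strict Implicit.
Unset Printing Implicit Defensive.

Import GRing.Theory.
Local Open Scope ring_scope.

(** * Identification of vertices, up to its kernel *)

Definition merge (U : finType) (B : {set U}) (u : U) : option U :=
  if u \in B then None else Some u.

Lemma merge_eq (U : finType) (B : {set U}) (u v : U) :
  (merge B u == merge B v) = (u == v) || (u \in B) && (v \in B).
Proof.
rewrite /merge; have [->|uv] := eqVneq u v; first by rewrite eqxx.
by case: (u \in B); case: (v \in B) => //=; apply: negbTE.
Qed.

(** Each [merge] wraps the codomain in another [option], so maps obtained by different contractions
    cannot be compared as functions. What matters is only which vertices of [A] they identify. *)
Definition same_kernel (T U U' : finType) (A : {set T}) (g : T -> U)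
    (g' : T -> U') : Prop :=
  {in A &, forall u v, (g u == g v) = (g' u == g' v)}.

Lemma same_kernel_sym (T U U' : finType) (A : {set T}) (g : T -> U)
    (g' : T -> U') : same_kernel A g g' -> same_kernel A g' g.
Proof. by move=> gg' u v uA vA; rewrite gg'. Qed.

Lemma same_kernel_sub (T U U' : finType) (A B : {set T}) (g : T -> U)
    (g' : T -> U') : B \subset A -> same_kernel A g g' -> same_kernel B g g'.
Proof. by move=> /subsetP BA gg' u v /BA uA /BA vA; apply: gg'. Qed.

Lemma same_kernel_imset (T U U' : finType) (A e : {set T}) (g : T -> U)
    (g' : T -> U') (u : T) :
  same_kernel A g g' -> e \subset A -> u \in A ->
  (g u \in g @: e) = (g' u \in g' @: e).
Proof.
move=> gg' /subsetP eA uA.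
apply/imsetP/imsetP => -[v ve /eqP guv]; exists v => //; apply/eqP.
  by rewrite -gg' // eA.
by rewrite gg' // eA.
Qed.

Lemma same_kernel_merge (T U U' : finType) (A e : {set T}) (g : T -> U)
    (g' : T -> U') :
  same_kernel A g g' -> e \subset A ->
  same_kernel A (merge (g @: e) \o g) (merge (g' @: e) \o g').
Proof.
move=> gg' eA u v uA vA /=; rewrite !merge_eq gg' //.
by rewrite !(same_kernel_imset gg' eA).
Qed.

Lemma same_kernel_card (T U U' : finType) (A : {set T}) (g : T -> U)
    (g' : T -> U') : same_kernel A g g' -> #|g @: A| = #|g' @: A|.
Proof.
suff le (V V' : finType) (h : T -> V) (h' : T -> V') :
    same_kernel A h h' -> (#|h' @: A| <= #|h @: A|)%N.
  by move=> gg'; apply/eqP; rewrite eqn_leq !le //; apply: same_kernel_sym.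
move=> hh'; rewrite -(card_imset _ Some_inj).
(* [k] carries a value of [h] to the value of [h'] at a chosen preimage in [A]. Equality of the
   kernels makes the choice irrelevant, so [k] maps the image of [h] onto that of [h']. *)
pose k u := omap h' [pick v in A | h v == u].
suff -> : Some @: (h' @: A) = k @: (h @: A) by apply: leq_imset_card.
rewrite -!imset_comp; apply: eq_in_imset => v vA /=; rewrite /k.
case: pickP => [u /andP[uA huv]|/(_ v)]; last by rewrite vA eqxx.
by congr Some; apply/eqP; rewrite eq_sym -hh'.
Qed.

(** * Evaluation along a list of edges in a fixed vertex set *)

Section Evaluation.
Variables (F : fieldType) (x w y z : F).

(* Eliminates the edges of [s] in the listed order inside a fixed vertex set
   [T]: [A] is the set of vertices that have not been extracted, and [g]
   identifies the vertices that have been contracted to one. An edge that is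
   not contained in [A] has been extracted with one of its endpoints. *)
Fixpoint psi (T : finType) (s : seq {set T}) (U : finType) (g : T -> U)
    (A : {set T}) {struct s} : F :=
  if s is e :: s' then
    if e \subset A then
      w * psi s' g A + y * psi s' (merge (g @: e) \o g) A
        + z * psi s' g [set v in A | g v \notin g @: e]
    else psi s' g A
  else x ^+ #|g @: A|.

Lemma psi_same_kernel (T U U' : finType) (s : seq {set T}) (g : T -> U)
    (g' : T -> U') (A : {set T}) :
  same_kernel A g g' -> psi s g A = psi s g' A.
Proof.
elim: s U U' g g' A => [|e s IHs] U U' g g' A gg' /=.
  by rewrite (same_kernel_card gg').
case: ifP => eA; last exact: IHs.
have -> : [set v in A | g' v \notin g' @: e]
    = [set v in A | g v \notin g @: e].
  apply/setP => v; rewrite !inE; case vA: (v \in A) => //=.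
  by rewrite (same_kernel_imset gg' eA vA).
congr (_ * _ + _ * _ + _ * _); apply: IHs => //.
  exact: same_kernel_merge.
by apply: same_kernel_sub gg'; apply/subsetP => v; rewrite inE => /andP[].
Qed.

(** An edge not contained in [A] is skipped, and [A] only shrinks during the recursion, so such
    edges may be dropped in advance. *)
Lemma psi_filter (T U : finType) (P : pred {set T}) (s : seq {set T})
    (g : T -> U) (A : {set T}) :
  (forall e : {set T}, e \in s -> e \subset A -> P e) ->
  psi (filter P s) g A = psi s g A.
Proof.
elim: s U g A => [|e s IHs] U g A //= AP.
have AsP f : f \in s -> f \subset A -> P f.
  by move=> fs; apply: AP; rewrite inE fs orbT.
case: ifP => /= Pe; last first.
  by case: ifP => eA; [rewrite AP ?mem_head in Pe | rewrite IHs].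
case: ifP => eA; rewrite !IHs // => f fs fA; apply: AsP => //.
by apply: subset_trans fA _; apply/subsetP => v; rewrite inE => /andP[].
Qed.

(** Identifying after transport along [h] is identifying by [g \o h]. The inclusion in the image of
    [h] gives each counted vertex a preimage, which the final power of [x] requires. *)
Lemma psi_imset (T T' U : finType) (h : T -> T') (s : seq {set T})
    (g : T' -> U) (B : {set T'}) :
  B \subset h @: setT ->
  psi (map (fun e : {set T} => h @: e) s) g B = psi s (g \o h) (h @^-1: B).
Proof.
elim: s U g B => [|e s IHs] U g B Bh /=.
  rewrite imset_comp; suff -> : h @: (h @^-1: B) = B by [].
  apply/setP => v; apply/imsetP/idP => [[u]|vB]; first by rewrite inE => ? ->.
  by have /imsetP[u _ vu] := subsetP Bh v vB; exists u; rewrite // inE -vu.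
rewrite sub_imset_pre imset_comp; case: ifP => _; rewrite !IHs //; last first.
  by apply: subset_trans Bh; apply/subsetP => v; rewrite inE => /andP[].
by congr (_ + _ * psi s _ _); apply/setP => v; rewrite !inE.
Qed.

(** Multiplicativity, by induction on the list. The sets [P] and [Q] stay fixed while extraction
    shrinks [A] and [B], so every edge remains assigned to one side. Nonemptiness keeps an edge of
    one side from being contained in the other. *)
Lemma psi_union (T U : finType) (s : seq {set T}) (g : T -> U)
    (A B P Q : {set T}) :
  A \subset P -> B \subset Q -> [disjoint P & Q] ->
  {in s, forall e : {set T}, e != set0 /\ (e \subset P \/ e \subset Q)} ->
  {in A & B, forall u v, g u != g v} ->
  psi s g (A :|: B) = psi s g A * psi s g B.
Proof.
elim: s U g A B P Q => [|e s IHs] U g A B P Q AP BQ PQ sPQ sep.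
  rewrite /= -exprD imsetU cardsU; congr (_ ^+ _).
  suff -> : g @: A :&: g @: B = set0 by rewrite cards0 subn0.
  apply/setP => u; rewrite !inE; apply/andP => -[/imsetP[a aA ->]].
  by case/imsetP=> b bB /eqP; rewrite (negbTE (sep a b aA bB)).
(* The two sides play symmetric roles, the product being commutative. *)
wlog eP : A B P Q AP BQ PQ sPQ sep / e \subset P.
  move=> wl; have [_ [eP|eQ]] := sPQ e (mem_head _ _).
    exact: (wl A B P Q).
  rewrite setUC mulrC; apply: (wl B A Q P) => //; first by rewrite disjoint_sym.
    by move=> f /sPQ[? []]; split=> //; [right | left].
  by move=> u v uB vA; rewrite eq_sym sep.
have [e0 _] := sPQ e (mem_head _ _).
have {}sPQ : {in s, forall e : {set T},
    e != set0 /\ (e \subset P \/ e \subset Q)}.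
  by move=> f fs; apply: sPQ; rewrite inE fs orbT.
have PB u : u \in P -> u \in B = false.
  by move=> uP; apply/negP => /(subsetP BQ); rewrite (disjointFr PQ uP).
have eAB : (e \subset A :|: B) = (e \subset A).
  apply/subsetP/subsetP => eA u ue; last by rewrite inE eA.
  by have := eA u ue; rewrite inE PB ?orbF // (subsetP eP).
have eB : (e \subset B) = false.
  have /set0Pn[u ue] := e0; apply/negP => /subsetP/(_ u ue).
  by rewrite PB // (subsetP eP).
rewrite /= eAB eB; case: ifP => eA; last exact: IHs sPQ sep.
have gB u : u \in B -> (g u \in g @: e) = false.
  move=> uB; apply/negP => /imsetP[v ve /eqP]; rewrite eq_sym.
  by apply/negP; rewrite sep // (subsetP eA).
have sepm : {in A & B, forall u v,
    (merge (g @: e) \o g) u != (merge (g @: e) \o g) v}.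
  by move=> u v uA vB /=; rewrite merge_eq (gB v) // andbF orbF sep.
rewrite (IHs _ g A B P Q) // (IHs _ _ A B P Q) //.
set A' := [set v in A | _].
have -> : [set v in A :|: B | g v \notin g @: e] = A' :|: B.
  apply/setP => v; rewrite !inE andb_orl; congr (_ || _).
  by case vB: (v \in B); rewrite // gB.
have A'A : A' \subset A by apply/subsetP => v; rewrite inE => /andP[].
rewrite (IHs _ g A' B P Q) //; first last.
- by move=> u v /(subsetP A'A); apply: sep.
- exact: subset_trans AP.
(* No vertex of [B] is identified with an end of [e], so contracting [e] leaves the [B] factor
   unchanged and it can be factored out of all three terms. *)
rewrite (@psi_same_kernel _ _ _ s (merge (g @: e) \o g) g B); first by ring.
by move=> u v uB vB /=; rewrite merge_eq gB // orbF.
Qed.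

(** * Exchange of two consecutive edges *)

Definition avoid (T U : finType) (g : T -> U) (e A : {set T}) : {set T} :=
  [set v in A | g v \notin g @: e].

Lemma avoid_sub (T U : finType) (g : T -> U) (e A : {set T}) :
  avoid g e A \subset A.
Proof. by apply/subsetP => v; rewrite inE => /andP[]. Qed.

Lemma psi_cons (T U : finType) (e : {set T}) (s : seq {set T}) (g : T -> U)
    (A : {set T}) :
  e \subset A ->
  psi (e :: s) g A = w * psi s g A + y * psi s (merge (g @: e) \o g) A
    + z * psi s g (avoid g e A).
Proof. by rewrite /= => ->. Qed.

Lemma psi_skip (T U : finType) (e : {set T}) (s : seq {set T}) (g : T -> U)
    (A : {set T}) :
  ~~ (e \subset A) -> psi (e :: s) g A = psi s g A.
Proof. by rewrite /= => /negbTE ->. Qed.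

Lemma sub_avoid (T U : finType) (g : T -> U) (e f A : {set T}) :
  f \subset A -> (f \subset avoid g e A) = [disjoint g @: e & g @: f].
Proof.
move=> /subsetP fA; rewrite disjoint_sym.
apply/subsetP/pred0P => [fe u /=|fe v vf].
  apply/andP => -[/imsetP[v vf ->]] gve.
  by have := fe v vf; rewrite inE gve andbF.
rewrite inE fA //=; apply/negP => gve; have := fe (g v).
by rewrite /= gve imset_f.
Qed.

Lemma mem_merge (T U : finType) (g : T -> U) (e f : {set T}) (v : T) :
  (merge (g @: e) (g v) \in (merge (g @: e) \o g) @: f) =
  (g v \in g @: f) || (g v \in g @: e) && ~~ [disjoint g @: e & g @: f].
Proof.
apply/imsetP/idP => [[u uf /eqP]|/orP[/imsetP[u uf ->]|/andP[gve]]].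
- rewrite /= merge_eq => /orP[/eqP ->|/andP[-> gue]]; first by rewrite imset_f.
  apply/orP; right; apply/pred0Pn; exists (g u) => /=.
  by rewrite gue imset_f.
- by exists u.
- case/pred0Pn=> a /andP[/= gue /imsetP[u uf gu]]; rewrite gu in gue.
  exists u => //.
  by apply/eqP; rewrite /= merge_eq gve gue orbT.
Qed.

(** If the edges meet, both orders collapse their union to one point; otherwise they give two
    separate points, labelled [None] and [Some None] in opposite ways. Hence only the kernels
    agree. *)
Lemma merge_swap (T U : finType) (g : T -> U) (e f A : {set T}) :
  same_kernel A
    (merge ((merge (g @: e) \o g) @: f) \o (merge (g @: e) \o g))
    (merge ((merge (g @: f) \o g) @: e) \o (merge (g @: f) \o g)).
Proof.
move=> u v _ _ /=; rewrite !merge_eq !mem_merge.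
rewrite [[disjoint g @: f & _]]disjoint_sym.
case: (g u == g v); case: (g u \in g @: e); case: (g u \in g @: f);
  case: (g v \in g @: e); case: (g v \in g @: f); by case: [disjoint _ & _].
Qed.

(** Extracting the first edge destroys the second, so its term has coefficient [z], while extraction
    of the second edge after deletion of the first has coefficient [w * z]. All other terms are
    symmetric in [e] and [f]. *)
Lemma psi_swap_meet (T U : finType) (e f : {set T}) (s : seq {set T})
    (g : T -> U) (A : {set T}) :
  e \subset A -> f \subset A -> ~~ [disjoint g @: e & g @: f] ->
  psi (e :: f :: s) g A - psi (f :: e :: s) g A =
  z * (1 - w) * (psi s g (avoid g e A) - psi s g (avoid g f A)).
Proof.
move=> eA fA ef; rewrite !(psi_cons _ _ eA) !(psi_cons _ _ fA).
rewrite !(psi_cons _ _ eA) [psi (f :: s) g _]psi_skip ?sub_avoid //.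
rewrite [psi (e :: s) g _]psi_skip ?sub_avoid 1?disjoint_sym //.
rewrite (psi_same_kernel _ (merge_swap g e f (A := A))).
have -> : avoid (merge (g @: e) \o g) f A = avoid (merge (g @: f) \o g) e A.
  apply/setP => v; rewrite !inE !mem_merge.
  by rewrite [[disjoint g @: f & _]]disjoint_sym ef !andbT orbC.
(* [D] is what remains after contracting one edge and extracting the other. It contains no vertex of
   either edge, so both merges have the kernel of [g] there. *)
set D := avoid _ e A.
rewrite (@psi_same_kernel _ _ _ s (merge (g @: e) \o g)
  (merge (g @: f) \o g) D).
  by ring.
move=> u v; rewrite !inE !mem_merge !merge_eq.
rewrite [[disjoint g @: f & _]]disjoint_sym ef !andbT !negb_or.
by case/and3P=> _ /negbTE -> /negbTE -> /and3P[_ /negbTE -> /negbTE ->].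
Qed.

(** Each edge survives the extraction of the other, and all operations on the two edges commute, so
    the expansion into nine terms is symmetric. *)
Lemma psi_swap_disjoint (T U : finType) (e f : {set T}) (s : seq {set T})
    (g : T -> U) (A : {set T}) :
  e \subset A -> f \subset A -> [disjoint g @: e & g @: f] ->
  psi (e :: f :: s) g A = psi (f :: e :: s) g A.
Proof.
move=> eA fA ef; rewrite !(psi_cons _ _ eA) !(psi_cons _ _ fA).
rewrite !(psi_cons _ _ eA) [psi (f :: s) g _]psi_cons ?sub_avoid //.
rewrite [psi (e :: s) g _]psi_cons ?sub_avoid 1?disjoint_sym //.
rewrite (psi_same_kernel _ (merge_swap g e f (A := A))).
have -> : avoid (merge (g @: e) \o g) f A = avoid g f A.
  by apply/setP => v; rewrite !inE mem_merge ef andbF orbF.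
have -> : avoid (merge (g @: f) \o g) e A = avoid g e A.
  by apply/setP => v; rewrite !inE mem_merge disjoint_sym ef andbF orbF.
have -> : avoid g f (avoid g e A) = avoid g e (avoid g f A).
  by apply/setP => v; rewrite !inE -!andbA; congr (_ && _); rewrite andbC.
by ring.
Qed.

(** * Independence of the order of elimination *)

Section PermutationInvariance.
Hypothesis zw : z = 0 \/ w = 1.

Lemma psi_swap (T U : finType) (e f : {set T}) (s : seq {set T}) (g : T -> U)
    (A : {set T}) :
  psi (e :: f :: s) g A = psi (f :: e :: s) g A.
Proof.
have skip (a b : {set T}) : ~~ (a \subset A) ->
    psi (a :: b :: s) g A = psi (b :: a :: s) g A.
  move=> aA; rewrite psi_skip //; have [bA|bA] := boolP (b \subset A).
    rewrite !(psi_cons _ _ bA) !psi_skip //.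
    apply: contra aA => /subset_trans; apply; exact: avoid_sub.
  by rewrite !psi_skip.
have [eA|/skip //] := boolP (e \subset A).
have [fA|/skip //] := boolP (f \subset A).
have [ef|ef] := boolP [disjoint g @: e & g @: f].
  exact: psi_swap_disjoint.
apply/eqP; rewrite -subr_eq0 psi_swap_meet //.
by case: zw => ->; rewrite ?subrr ?mulr0 !mul0r.
Qed.

Lemma psi_perm (T U : finType) (s t : seq {set T}) (g : T -> U) (A : {set T}) :
  perm_eq s t -> psi s g A = psi t g A.
Proof.
have cons_congr (e : {set T}) s1 s2 :
    (forall (V : finType) (h : T -> V) B, psi s1 h B = psi s2 h B) ->
    forall (V : finType) (h : T -> V) B, psi (e :: s1) h B = psi (e :: s2) h B.
  by move=> E V h B /=; rewrite !E.
elim: s t U g A => [|e s IHs] t U g A st.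
  by move: st; rewrite perm_sym => /perm_nilP ->.
have et : e \in t by rewrite -(perm_mem st) mem_head.
(* The head [e] of [s] is located inside [t]. Induction rearranges the other edges, after which [e]
   is moved past [t1] by adjacent swaps. *)
case/splitPr: et st => t1 t2; rewrite perm_sym perm_catC cat_cons perm_cons.
rewrite perm_catC perm_sym => st.
transitivity (psi (e :: t1 ++ t2) g A).
  by apply: cons_congr => V h B; apply: IHs.
elim: t1 {st IHs} U g A => // e1 t1 IHt U g A.
by rewrite !cat_cons psi_swap; apply: cons_congr => V h B; apply: IHt.
Qed.

End PermutationInvariance.

(** * From lists of sets to multigraphs *)

Lemma psi_embedding (T T' : finType) (h : T -> T') (s : seq {set T}) :
  injective h ->
  psi (map (fun e : {set T} => h @: e) s) id (h @: setT) = psi s id setT.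
Proof.
move=> inj_h; rewrite psi_imset //.
have -> : h @^-1: (h @: setT) = setT by apply/setP => v; rewrite !inE imset_f.
by apply: psi_same_kernel => u v _ _ /=; rewrite (inj_eq inj_h).
Qed.

Definition value (G : multigraph) (s : seq (edge G)) : F :=
  psi (map (@ends G) s) id setT.

(** [contraction_map e] and [merge (ends e)] have the same kernel: both collapse exactly the ends of
    [e]. *)
Lemma psi_contraction (G : multigraph) (e : edge G)
    (t : seq {f : edge G | f != e}) :
  @value (contraction e) t =
  psi (map (@ends G) (map val t)) (merge (ends e)) setT.
Proof.
have surj : setT \subset contraction_map e @: setT.
  apply/subsetP => -[u|] _; apply/imsetP.
    by exists (val u); rewrite // /contraction_map valK.
  (* The point [None] has a preimage because an edge has at least one end. *)
  have /andP[/card_gt0P[u ue] _] := ends_card e.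
  by exists u; rewrite // /contraction_map insubF // ue.
have -> : @value (contraction e) t =
    psi (map (fun f : {set vertex G} => contraction_map e @: f)
      (map (@ends G) (map val t))) id setT by rewrite /value -!map_comp.
rewrite psi_imset // preimsetT; apply: psi_same_kernel => u v _ _ /=.
rewrite merge_eq /contraction_map.
case: insubP => [a ua ua'|]; case: insubP => [b vb vb'|]; rewrite ?negbK.
- by rewrite (negbTE ua) orbF -ua' -vb'.
- move=> ve; rewrite (negbTE ua) orbF.
  by apply/esym/eqP => uv; rewrite uv ve in ua.
- move=> ue; rewrite (negbTE vb) andbF orbF.
  by apply/esym/eqP => uv; rewrite -uv ue in vb.
- by move=> -> ->; rewrite orbT.
Qed.

(** Edges meeting [ends e] are skipped once the vertex set is the complement of [ends e]. The others
    are the edges of the extraction, embedded by [val]. *)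
Lemma psi_extraction (G : multigraph) (e : edge G) (s : seq (edge G))
    (t : seq (extraction_edge e)) :
  map val t = [seq f <- s | [disjoint ends f & ends e]] ->
  @value (extraction e) t = psi (map (@ends G) s) id (~: ends e).
Proof.
move=> ts.
rewrite -(@psi_filter _ _ (fun f => [disjoint f & ends e])); last first.
  by move=> f _; rewrite subsets_disjoint setCK.
have -> : ~: ends e = val @: [set: extraction_vertex e].
  apply/setP => v; rewrite inE; apply/idP/imsetP => [ve|[u _ ->]].
    by exists (Sub v ve).
  exact: valP u.
rewrite /value -(psi_embedding _ val_inj) filter_map -ts -!map_comp.
apply: (congr1 (fun l => psi l id _)); apply: eq_map => f /=.
apply/esym/setP => v; apply/idP/imsetP => [vf|[u]].
  have ve : v \notin ends e by rewrite (disjointFr (valP f) vf).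
  by exists (Sub v ve); rewrite ?inE SubK.
by rewrite inE => ? ->.
Qed.

(** * Complete edge orders and the edge elimination rule *)

Definition edge_listing (G : multigraph) (s : seq (edge G)) : Prop :=
  uniq s /\ s =i predT.

(** The edges of a deletion, contraction or extraction form a subtype of those of [G]; [pmap insub]
    restricts an order to it. *)
Lemma pmap_insub_listing (T : eqType) (P : pred T) (sT : subEqType P)
    (s : seq T) :
  uniq s -> {in P, forall f, f \in s} ->
  uniq (pmap insub s : seq sT) /\ (pmap insub s : seq sT) =i predT.
Proof.
move=> us sP; split; first exact: pmap_sub_uniq.
by move=> f; rewrite mem_pmap_sub inE sP //; apply: (valP f).
Qed.

Lemma edge_listing_enum (G : multigraph) : edge_listing (enum (edge G)).
Proof. by split=> [|f]; rewrite ?enum_uniq ?mem_enum. Qed.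

Lemma edge_listing_behead (G : multigraph) (e : edge G) (s : seq (edge G)) :
  edge_listing (e :: s) -> uniq s /\ forall f, f != e -> f \in s.
Proof.
move=> [/= /andP[_ us] es]; split=> // f fe.
by have := es f; rewrite !inE (negbTE fe).
Qed.

Lemma edge_listing_deletion (G : multigraph) (e : edge G) (s : seq (edge G)) :
  edge_listing (e :: s) -> @edge_listing (deletion e) (pmap insub s).
Proof. by case/edge_listing_behead=> us se; apply: pmap_insub_listing. Qed.

Lemma edge_listing_contraction (G : multigraph) (e : edge G)
    (s : seq (edge G)) :
  edge_listing (e :: s) -> @edge_listing (contraction e) (pmap insub s).
Proof. by case/edge_listing_behead=> us se; apply: pmap_insub_listing. Qed.

Lemma edge_listing_extraction (G : multigraph) (e : edge G)
    (s : seq (edge G)) :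
  edge_listing (e :: s) -> @edge_listing (extraction e) (pmap insub s).
Proof.
case/edge_listing_behead=> us se; apply: pmap_insub_listing => // f.
(* [e] has an end, so it is not disjoint from itself and is not an edge of its extraction. *)
rewrite unfold_in => fe; apply: se; apply: contraTneq fe => ->.
rewrite -setI_eq0 setIid -card_gt0.
by have /andP[] := ends_card e.
Qed.

(** Rule (i) at the first edge of the order: the three branches of [psi] are the values of the three
    smaller graphs along the induced orders. *)
Lemma value_cons (G : multigraph) (e : edge G) (s : seq (edge G)) :
  edge_listing (e :: s) ->
  value (e :: s) = w * @value (deletion e) (pmap insub s)
    + y * @value (contraction e) (pmap insub s)
    + z * @value (extraction e) (pmap insub s).
Proof.
move=> es; have [us se] := edge_listing_behead es.
have tE : map val (pmap insub s : seq {f | f != e}) = s.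
  rewrite (pmap_filter (@insubK _ _ _)); apply/all_filterP/allP => f fs.
  rewrite isSome_insub; apply: contraTneq fs => ->.
  by case: es => /= /andP[].
have delE : @value (deletion e) (pmap insub s) = value s.
  by rewrite /value -[in RHS]tE -!map_comp.
rewrite psi_contraction tE delE (psi_extraction (s := s)); last first.
  rewrite (pmap_filter (@insubK _ _ _)); apply: eq_filter => f.
  by rewrite /= isSome_insub.
rewrite {1}/value [map _ _]/= psi_cons // imset_id.
congr (_ + _ + _ * _); apply: (congr1 (fun A => psi _ id A)).
by apply/setP => v; rewrite !inE imset_id.
Qed.

(** * Every order is a legitimate evaluation *)

Lemma eq_card_bijective (T T' : finType) :
  #|T| = #|T'| -> exists f : T -> T', bijective f.
Proof.
move=> TT'; exists (enum_val \o cast_ord TT' \o enum_rank).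
apply: bij_comp (enum_rank_bij T).
apply: bij_comp (enum_val_bij T') _.
by exists (cast_ord (esym TT')); [apply: cast_ordK | apply: cast_ordKV].
Qed.

Lemma isomorphic_edgeless (G H : multigraph) :
  #|edge G| = 0%N -> #|edge H| = 0%N -> #|vertex G| = #|vertex H| ->
  isomorphic G H.
Proof.
move=> G0 H0 GH.
have [f bf] := eq_card_bijective GH.
have [g bg] := eq_card_bijective (etrans G0 (esym H0)).
by exists f, g; split=> // e; have := card0_eq G0 e.
Qed.

Lemma evaluates_edgeless (G : multigraph) :
  #|edge G| = 0%N -> evaluates x w y z G (x ^+ #|vertex G|).
Proof.
move: {2}#|vertex G| (erefl #|vertex G|) => n; elim: n G => [|n IHn] G Gn G0.
  rewrite Gn; apply: eval_iso (eval_empty x w y z).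
  by apply: isomorphic_edgeless; rewrite ?card_void // Gn card_void.
have voids : #|edge (disjoint_union one_vertex_graph (edgeless 'I_n))| = 0%N.
  by rewrite card_sum card_void.
rewrite Gn exprS; apply: (@eval_iso _ _ _ _ _
  (disjoint_union one_vertex_graph (edgeless 'I_n))).
  by apply: isomorphic_edgeless => //; rewrite Gn card_sum card_unit card_ord.
apply: eval_union; first exact: eval_one_vertex.
by rewrite -[n in x ^+ n]card_ord; apply: IHn; rewrite /= ?card_ord ?card_void.
Qed.

(** Induction on a bound for the length of the order, since [G] itself changes at each step. When
    the list is exhausted, the graph is edgeless and splits into single vertices. *)
Lemma evaluates_value (G : multigraph) (s : seq (edge G)) :
  edge_listing s -> evaluates x w y z G (value s).
Proof.
move: {2}(size s) (leqnn (size s)) => n.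
elim: n G s => [|n IHn] G [|e s] //= sn es; rewrite ?ltnS in sn.
1,2: have -> : @value G [::] = x ^+ #|vertex G|
  by rewrite -cardsT -[in RHS](imset_id setT).
1,2: apply: evaluates_edgeless; apply: eq_card0 => e; have := es.2 e.
1,2: by rewrite !inE.
have size_le (P : pred (edge G)) (sT : subType P) :
    (size (pmap insub s : seq sT) <= n)%N.
  by rewrite size_pmap_sub (leq_trans (count_size _ _)).
rewrite value_cons //; apply: (@eval_edge _ _ _ _ _ _ e).
- exact: (IHn (deletion e) _ (size_le _ _)) (edge_listing_deletion es).
- exact: (IHn (contraction e) _ (size_le _ _)) (edge_listing_contraction es).
- exact: (IHn (extraction e) _ (size_le _ _)) (edge_listing_extraction es).
Qed.

(** * Isomorphism, disjoint union and uniqueness of the value *)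

Lemma value_isomorphic (G H : multigraph) (f : vertex G -> vertex H)
    (g : edge G -> edge H) (s : seq (edge G)) :
  bijective f -> (forall e, ends (g e) = f @: ends e) ->
  value (map g s) = value s.
Proof.
move=> bf fg; rewrite /value.
have -> : map (@ends H) (map g s) =
    map (fun e : {set vertex G} => f @: e) (map (@ends G) s).
  by rewrite -!map_comp; apply: eq_map.
have [f' fK f'K] := bf.
rewrite -(psi_embedding _ (can_inj fK)).
apply: (congr1 (fun A => psi _ id A)).
by apply/esym/setP => v; rewrite inE -(f'K v) imset_f.
Qed.

(** [psi_union] leaves the whole list in both factors; in each of them the edges of the other side
    are then filtered out. *)
Lemma psi_cat (T : finType) (s t : seq {set T}) (P Q : {set T}) :
  [disjoint P & Q] ->
  {in s, forall e : {set T}, e != set0 /\ e \subset P} ->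
  {in t, forall e : {set T}, e != set0 /\ e \subset Q} ->
  psi (s ++ t) id (P :|: Q) = psi s id P * psi t id Q.
Proof.
move=> PQ sP tQ; rewrite (@psi_union _ _ _ _ P Q P Q) //; first last.
- by move=> u v uP; apply: contraTneq => /= <-; rewrite (disjointFr PQ uP).
- move=> e; rewrite mem_cat => /orP[/sP[? ?]|/tQ[? ?]]; split=> //.
    by left.
  by right.
have filter_sub (l : seq {set T}) (R : {set T}) :
    {in l, forall e : {set T}, e != set0 /\ e \subset R} ->
    [seq e : {set T} <- l | e \subset R] = l.
  by move=> lR; apply/all_filterP/allP => e /lR[].
have filter_disjoint (l : seq {set T}) (R R' : {set T}) : [disjoint R & R'] ->
    {in l, forall e : {set T}, e != set0 /\ e \subset R} ->
    [seq e : {set T} <- l | e \subset R'] = [::].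
  move=> RR' lR; rewrite (eq_in_filter (a2 := pred0)) ?filter_pred0 //.
  move=> e /lR[/set0Pn[v ve] /subsetP eR]; apply/negP => /subsetP/(_ v ve).
  by rewrite (disjointFr RR' (eR v ve)).
rewrite -(@psi_filter _ _ (fun e : {set T} => e \subset P)) //.
rewrite -[psi _ _ Q](@psi_filter _ _ (fun e : {set T} => e \subset Q)) //.
rewrite !filter_cat (filter_sub s P) // (filter_sub t Q) //.
rewrite (filter_disjoint s P Q) // (filter_disjoint t Q P) ?cats0 //.
by rewrite disjoint_sym.
Qed.

Lemma value_disjoint_union (G1 G2 : multigraph) (s1 : seq (edge G1))
    (s2 : seq (edge G2)) :
  @value (disjoint_union G1 G2) (map inl s1 ++ map inr s2) =
  value s1 * value s2.
Proof.
have inl_inj : injective (@inl (vertex G1) (vertex G2)) by move=> u v [].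
have inr_inj : injective (@inr (vertex G1) (vertex G2)) by move=> u v [].
rewrite /value -(psi_embedding _ inl_inj) -(psi_embedding _ inr_inj).
have nz (e : edge (disjoint_union G1 G2)) : ends e != set0.
  by rewrite -card_gt0; have /andP[] := ends_card e.
rewrite -psi_cat; first last.
- move=> _ /mapP[_ /mapP[e _ ->] ->].
  by split; [apply: (nz (inr e)) | apply/imsetS/subsetT].
- move=> _ /mapP[_ /mapP[e _ ->] ->].
  by split; [apply: (nz (inl e)) | apply/imsetS/subsetT].
- by apply/pred0P => v; apply/andP => -[/imsetP[a _ ->] /imsetP[]].
have -> : inl @: setT :|: inr @: setT = [set: vertex G1 + vertex G2].
  by apply/setP => -[v|v]; rewrite !inE imset_f ?orbT.
by rewrite map_cat -!map_comp.
Qed.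

Lemma value_listing (G : multigraph) (s t : seq (edge G)) :
  z = 0 \/ w = 1 -> edge_listing s -> edge_listing t -> value s = value t.
Proof.
move=> zw [us sE] [ut tE]; apply: psi_perm => //; apply: perm_map.
by apply: uniq_perm => // e; rewrite sE tE.
Qed.

Lemma evaluates_eq_value (G : multigraph) (a : F) (s : seq (edge G)) :
  z = 0 \/ w = 1 -> evaluates x w y z G a -> edge_listing s -> a = value s.
Proof.
move=> zw Ga; elim: Ga s => {G a}
  [G e a b c _ IHa _ IHb _ IHc|G1 G2 a b _ IHa _ IHb| | |G H a GH _ IHa] s sE.
(* The derivation eliminates [e] first, whereas [s] may list it anywhere. Independence of the order
   allows [e] to be moved to the front. *)
- have es : edge_listing (e :: rem e s).
    have [us se] := sE; have es : e \in s by rewrite se.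
    split=> [|f]; first by rewrite -(perm_uniq (perm_to_rem es)).
    by rewrite -(perm_mem (perm_to_rem es)).
  rewrite (value_listing zw sE es) value_cons //.
  rewrite -(IHa _ (edge_listing_deletion es)).
  rewrite -(IHb _ (edge_listing_contraction es)).
  by rewrite -(IHc _ (edge_listing_extraction es)).
- rewrite (IHa _ (edge_listing_enum G1)) (IHb _ (edge_listing_enum G2)).
  rewrite -value_disjoint_union.
  apply: value_listing => //; split=> [|[f|f]].
  - rewrite cat_uniq; apply/and3P; split.
    + by rewrite map_inj_uniq ?enum_uniq // => u v [].
    + by apply/hasPn => _ /mapP[f _ ->]; apply/mapP => -[].
    + by rewrite map_inj_uniq ?enum_uniq // => u v [].
  - by rewrite mem_cat map_f ?mem_enum.
  - by rewrite mem_cat orbC map_f ?mem_enum.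
- by case: s sE => [|[]] // _; rewrite /value /= imset_id cardsT card_unit.
- by case: s sE => [|[]] // _; rewrite /value /= imset_id cardsT card_void.
- have [f [g [bf [g' gK g'K] fg]]] := GH.
  (* The order on [H] is pulled back to [G] along the inverse of [g]. *)
  have -> : s = map g (map g' s).
    by rewrite -map_comp -[LHS]map_id; apply: eq_map => e /=; rewrite g'K.
  rewrite (value_isomorphic _ bf fg); apply: IHa; have [us se] := sE.
  split=> [|e]; first by rewrite map_inj_uniq //; apply: can_inj g'K.
  by rewrite -[e]gK map_f // se.
Qed.

(** * Consequences of confluence *)

Lemma confluent_swap (G : multigraph) (e f : edge G) (s : seq (edge G)) :
  confluent x w y z -> edge_listing [:: e, f & s] ->
  ~~ [disjoint ends e & ends f] -> z <> 0 -> w <> 1 ->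
  psi (map (@ends G) s) id (~: ends e) = psi (map (@ends G) s) id (~: ends f).
Proof.
move=> conf efs ef /eqP z0 /eqP w1.
have fes : edge_listing [:: f, e & s].
  have [us sE] := efs; split=> [|h]; last by have := sE h; rewrite !inE orbCA.
  by move: us; rewrite /= !inE !negb_or eq_sym => /and3P[/andP[-> ->] -> ->].
have := conf G _ _ (evaluates_value efs) (evaluates_value fes).
(* Both orders are evaluations, so their difference vanishes; its factor [z * (1 - w)] is nonzero
   and cancels. *)
move/eqP; rewrite -subr_eq0 psi_swap_meet ?imset_id ?subsetT //.
rewrite !mulf_eq0 (negbTE z0) subr_eq0 eq_sym (negbTE w1) /= subr_eq0.
have avoidE (h : {set vertex G}) : avoid id h setT = ~: h.
  by apply/setP => v; rewrite !inE imset_id.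
by rewrite !avoidE => /eqP.
Qed.

End Evaluation.

(** Booleans name both vertices and edges: edge [true] joins the two vertices, edge [false] is a
    loop at vertex [true]. Removing the ends of the loop leaves one vertex, removing those of the
    other edge leaves none. *)
Definition loop_edge_ends (b : bool) : {set bool} :=
  if b then setT else [set true].

Lemma loop_edge_ends_card b : (0 < #|loop_edge_ends b| <= 2)%N.
Proof. by case: b; rewrite /= ?cardsT ?card_bool ?cards1. Qed.

Definition loop_edge : multigraph := Multigraph loop_edge_ends_card.

(** The extra edge [None] is a loop at vertex [false], which survives the extraction of the loop at
    [true]. *)
Definition loop_edge_loop_ends (o : option bool) : {set bool} :=
  if o is Some b then loop_edge_ends b else [set false].

Lemma loop_edge_loop_ends_card o : (0 < #|loop_edge_loop_ends o| <= 2)%N.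
Proof. by case: o => [b|]; [apply: loop_edge_ends_card | rewrite cards1]. Qed.

Definition loop_edge_loop : multigraph := Multigraph loop_edge_loop_ends_card.

Theorem theorem1 (F : fieldType) (x w y z : F)
    (nonconstant : ~ (x = 1 /\ w + y + z = 1)) :
  confluent x w y z <-> z = 0 \/ w = 1.
Proof.
split=> [conf|zw G a b Ga Gb]; last first.
  rewrite (evaluates_eq_value zw Ga (edge_listing_enum G)).
  by rewrite (evaluates_eq_value zw Gb (edge_listing_enum G)).
have [->|/eqP z0] := eqVneq z 0; first by left.
have [->|/eqP w1] := eqVneq w 1; first by right.
have meet : ~~ [disjoint [set true] & [set: bool]].
  by apply/pred0Pn; exists true; rewrite !inE.
have CT : ~: [set true] = [set false] by apply/setP => -[]; rewrite !inE.
(* With [z] nonzero and [w] different from 1, confluence is shown to force exactly the excluded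
   case. *)
case: nonconstant.
have x1 : x = 1.
  have := @confluent_swap _ x w y z loop_edge false true [::] conf.
  rewrite /= CT setCT !imset_id cards1 cards0; apply=> //.
  by split=> [|[]].
split=> //.
have : psi x w y z [:: [set false]] id (~: [set true])
    = psi x w y z [:: [set false]] id (~: setT).
  apply: (@confluent_swap _ x w y z loop_edge_loop (Some false) (Some true)
    [:: None]) => //.
  by split=> [|[[]|]].
(* On the left the remaining loop is expanded to [(w + y) * x + z]; on the right no vertex is left,
   the loop is skipped and the value is 1. *)
rewrite CT setCT psi_cons // psi_skip ?sub1set ?inE //.
by rewrite /= x1 !expr1n !mulr1.
Qed.
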